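(* Let $\mathcal H(\zeta)=\sum_{n=0}^\infty \mathbf f_n\zeta^n$ be a formal power series in $\zeta$ with coefficients $\mathbf f_n\in\mathfrak R^{p\times q}$. Then the following are equivalent: (1) The components (entries) of $\mathcal H$ are obtained by adding, multiplying and dividing polynomials of $\mathfrak R[\zeta]$, with division being performed only when the constant coefficient (in $\zeta$) of the divisor is invertible in $\mathfrak R$. (2) $\mathcal H$ admits a realization of the form \[ \mathcal H(\zeta)=\mathbf D+\zeta\,\mathbf C(I_N-\zeta\mathbf A)^{-1}\mathbf B, \] for some $N$ and some matrices $\mathbf A\in\mathfrak R^{N\times N}$, $\mathbf B\in\mathfrak R^{N\times q}$, $\mathbf C\in\mathfrak R^{p\times N}$, $\mathbf D\in\mathfrak R^{p\times q}$. (3) The formal power series $\mathcal H$ converges in a neighborhood of the origin ($\zeta=0$ in $\mathbb C$), and there exists a finite number $M$ such that for every $n\ge M$ the function $R_0^n\mathcal H$ is a linear combination of $R_0\mathcal H,\ldots,R_0^{M-1}\mathcal H$ with coefficients in $\mathfrak R$.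
   Context: Let $\ell$ be the set of sequences $\alpha=(\alpha_1,\alpha_2,\ldots)$ with entries in $\{0,1,2,\ldots\}$ and only finitely many non-zero entries. For $\alpha\in\ell$ put $z^\alpha=z_1^{\alpha_1}z_2^{\alpha_2}\cdots$ (countably many complex variables $z=(z_1,z_2,\ldots)$) and $(2\mathbb N)^{c\alpha}=\prod_{j\ge1}(2j)^{c\alpha_j}$ for $c\in\mathbb Z$. For $k=1,2,\ldots$ let $\mathcal H_k$ be the Hilbert space of formal series $f=\sum_{\alpha\in\ell}f_\alpha H_\alpha$, $f_\alpha\in\mathbb C$, with $\|f\|_k=\left(\sum_{\alpha\in\ell}|f_\alpha|^2(2\mathbb N)^{-k\alpha}\right)^{1/2}<\infty$; here $(H_\alpha)_{\alpha\in\ell}$ is the Hermite-type orthogonal basis of the white noise space, which can be treated as formal symbols. The Kondratiev space is the inductive limit $S_{-1}=\bigcup_{k\ge1}\mathcal H_k$. The Hermite transform is $\mathbf I\left(\sum_\alpha f_\alpha H_\alpha\right)=\sum_{\alpha\in\ell}f_\alpha z^\alpha$, and $\mathfrak R=\mathbf I(S_{-1})$, a commutative ring (an integral domain containing $\mathbb C$ as the constant series) under the usual addition and multiplication of power series in $z$. Convergence in $\mathfrak R$ (entrywise for matrices) means convergence of the corresponding elements of $S_{-1}$. For this, the following is a known criterion: $F^{(n)}\to F$ in $S_{-1}$ if there exist $\delta>0$ and $r<\infty$ such that $\mathbf I(F^{(n)})\to\mathbf I(F)$ pointwise boundedly, or equivalently uniformly, on $K_r(\delta)=\{z\in\mathbb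 C^{\mathbb N}:\ \sum_{\alpha\in\ell,\ \alpha\neq(0,0,\ldots)}|z^\alpha|^2(2\mathbb N)^{r\alpha}<\delta^2\}$. For a power series $f(\zeta)=\sum_{n\ge0}f_n\zeta^n$ with coefficients in $\mathfrak R^{p\times q}$, $R_0f$ is defined by $(R_0f)(\zeta)=\dfrac{f(\zeta)-f(0)}{\zeta}=\sum_{n\ge0}f_{n+1}\zeta^n$, and $R_0^n$ is its $n$-th iterate. The expression $(I_N-\zeta\mathbf A)^{-1}$ stands, as a power series in $\zeta$, for $\sum_{n\ge0}\zeta^n\mathbf A^n$. *)

(* Defs.v *)
From HB Require Import structures.
From mathcomp Require Import all_boot all_order all_algebra.
From mathcomp Require Import finmap.
From mathcomp Require Import boolp classical_sets functions cardinality fsbigop.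
From mathcomp Require Import reals ereal esum topology.
From mathcomp Require Import complex.
From mathcomp Require Import lra.

Set Implicit Arguments.
Unset Strict Implicit.
Unset Printing Implicit Defensive.

Import Order.TTheory GRing.Theory Num.Theory.

Local Open Scope classical_set_scope.
Local Open Scope ring_scope.
Local Open Scope complex_scope.

Notation normc := ComplexField.Normc.normc.

(* Finitely supported sequences of naturals, indexed from 0: [a j] is the
   entry that is traditionally written alpha_(j+1). *)
Definition multi_index := {fsfun nat -> nat with 0%N}.

Definition mi0 : multi_index := [fsfun].

Definition miadd (a b : multi_index) : multi_index :=
  [fsfun j in (finsupp a `|` finsupp b)%fset => (a j + b j)%N].

Section MultiIndex.
Implicit Types a b c g : multi_index.

Lemma mi0E j : mi0 j = 0%N.
Proof. by rewrite fsfunE. Qed.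

Lemma miaddE a b j : miadd a b j = (a j + b j)%N.
Proof.
rewrite fsfunE inE; case: ifPn => // /norP[/fsfun_dflt -> /fsfun_dflt ->].
by [].
Qed.

Lemma miaddC : commutative miadd.
Proof. by move=> a b; apply/fsfunP => j; rewrite !miaddE addnC. Qed.

Lemma miaddA : associative miadd.
Proof. by move=> a b c; apply/fsfunP => j; rewrite !miaddE addnA. Qed.

Lemma mi0add : left_id mi0 miadd.
Proof. by move=> a; apply/fsfunP => j; rewrite !miaddE mi0E. Qed.

Definition mile a b := forall j, (a j <= b j)%N.

Definition mi_family_mem g (j : finsupp g) : pred 'I_(\max_(j : finsupp g) g (val j)).+1 :=
  fun i => (i <= g (val j))%N.
Arguments mi_family_mem : clear implicits.

Definition mi_of_ffun g (h : {ffun finsupp g -> 'I_(\max_(j : finsupp g) g (val j)).+1})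
  : multi_index := [fsfun j : finsupp g => nat_of_ord (h j)].

Definition midivs g : seq multi_index :=
  undup [seq mi_of_ffun h | h <- enum (family (mi_family_mem g))].

Lemma midivs_uniq g : uniq (midivs g).
Proof. exact: undup_uniq. Qed.

Lemma mem_midivs a g : mile a g -> a \in midivs g.
Proof.
move=> ag; rewrite mem_undup.
pose h : {ffun finsupp g -> 'I_(\max_(j : finsupp g) g (val j)).+1} :=
  [ffun j => inord (a (val j))].
have hE j : nat_of_ord (h j) = a (val j).
  rewrite ffunE inordK// ltnS (leq_trans (ag _))//.
  exact: (leq_bigmax (F := fun j : finsupp g => g (val j))).
have -> : a = mi_of_ffun h.
  apply/fsfunP => j; rewrite fsfun_ffun; case: insubP => [u _ <-|/= jg].
    by rewrite /= hE.
  by apply/eqP; rewrite -leqn0 (leq_trans (ag j))// fsfun_dflt.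
apply: map_f; rewrite mem_enum; apply/familyP => j.
by have hj := ag (val j); rewrite -hE in hj.
Qed.

Lemma mile_addl a b : mile a (miadd a b).
Proof. by move=> j; rewrite miaddE leq_addr. Qed.

Lemma mile_addr a b : mile b (miadd a b).
Proof. by move=> j; rewrite miaddE leq_addl. Qed.

Lemma midivsP a g : a \in midivs g -> exists b, miadd a b = g.
Proof.
rewrite mem_undup => /mapP[h]; rewrite mem_enum => /familyP hF ->.
exists [fsfun j in finsupp g => (g j - mi_of_ffun h j)%N].
apply/fsfunP => j; rewrite miaddE fsfunE.
case: ifPn => jg; last by rewrite addn0 fsfun_ffun insubN//= fsfun_dflt.
rewrite subnKC// fsfun_ffun; case: insubP => //= u _ <-.
exact: (hF u).
Qed.

Lemma size_midivs g : (size (midivs g) <= \prod_(j <- finsupp g) (g j).+1)%N.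
Proof.
apply: (leq_trans (size_undup _)); rewrite size_map -cardE card_family.
rewrite foldrE big_map big_seq_fsetE /= -[X in (_ <= X)%N]big_enum /=.
apply: leq_prod => j _; rewrite -(size_iota 0 (g (val j)).+1) cardE.
rewrite -(size_map val) uniq_leq_size//.
  by rewrite map_inj_uniq ?enum_uniq//; exact: val_inj.
apply/allP; rewrite all_map; apply/allP => i; rewrite mem_enum => iF.
change (val i \in iota 0 (g (val j)).+1).
by rewrite mem_iota add0n ltnS; exact: iF.
Qed.

Definition midecomp g : seq (multi_index * multi_index) :=
  [seq ab <- [seq (a, b) | a <- midivs g, b <- midivs g] | miadd ab.1 ab.2 == g].

Lemma mem_midecomp g ab : (ab \in midecomp g) = (miadd ab.1 ab.2 == g).
Proof.
rewrite mem_filter; case: eqP => //= abg; case: ab abg => a b /= abg.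
apply/allpairsP; exists (a, b); split => //=; apply: mem_midivs; rewrite -abg.
  exact: mile_addl.
exact: mile_addr.
Qed.

Lemma midecomp_uniq g : uniq (midecomp g).
Proof. by rewrite filter_uniq// allpairs_uniq ?midivs_uniq// => -[? ?] [? ?]. Qed.

Lemma size_midecomp g : (size (midecomp g) <= size (midivs g))%N.
Proof.
rewrite -(size_map fst); apply: uniq_leq_size.
  rewrite map_inj_in_uniq ?midecomp_uniq// => -[a b] [c d].
  rewrite !mem_midecomp /= => /eqP abg /eqP cdg ac; congr (_, _) => //.
  apply/fsfunP => j.
  have := congr1 (fun m : multi_index => m j) (etrans abg (esym cdg)).
  by rewrite !miaddE ac => /addnI.
move=> x /mapP[ab]; rewrite mem_midecomp => /eqP <- ->.
exact/mem_midivs/mile_addl.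
Qed.

Lemma midecomp_sum (K : pzRingType) g (r : seq multi_index) h :
  uniq r -> {subset midivs g <= r} ->
  \sum_(ab <- midecomp g) h ab =
  \sum_(a <- r) \sum_(b <- r) h (a, b) * (miadd a b == g)%:R :> K.
Proof.
move=> ur rg; set rr := [seq ab <- [seq (a, b) | a <- r, b <- r] | miadd ab.1 ab.2 == g].
have -> : \sum_(ab <- midecomp g) h ab = \sum_(ab <- rr) h ab.
  apply: perm_big; apply: uniq_perm => [||[a b]]; first exact: midecomp_uniq.
    by rewrite filter_uniq// allpairs_uniq => // -[? ?] [? ?].
  rewrite mem_midecomp mem_filter /=; case: eqP => //= abg.
  apply/esym/allpairsP; exists (a, b); split => //=; apply/rg/mem_midivs; rewrite -abg.
    exact: mile_addl.
  exact: mile_addr.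
rewrite big_filter big_mkcond big_allpairs /=.
apply: eq_bigr => a _; apply: eq_bigr => b _ /=.
by case: ifP; rewrite ?mulr1 ?mulr0.
Qed.

Lemma midecompE g :
  [set ab : multi_index * multi_index | miadd ab.1 ab.2 = g] = [set` midecomp g].
Proof. by apply/seteqP; split => ab /=; rewrite mem_midecomp => /eqP. Qed.

End MultiIndex.

(* Formal power series sum_a F_a z^a in the countably many variables
   z_1, z_2, ..., with the Cauchy product. *)
Record power_series (R : Type) := PowerSeries { coef : multi_index -> R[i] }.

Section PowerSeriesRing.
Variable R : realType.
Local Notation C := R[i].
Local Notation ps := (power_series R).
Implicit Types F G H : ps.

HB.instance Definition _ := gen_eqMixin ps.
HB.instance Definition _ := gen_choiceMixin ps.

Lemma psP F G : (forall a, coef F a = coef G a) <-> F = G.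
Proof.
by split=> [|-> //]; case: F G => f [g] /= fg; congr PowerSeries; apply/funext.
Qed.

Definition ps_zero : ps := PowerSeries (fun=> 0).
Definition ps_opp F : ps := PowerSeries (fun a => - coef F a).
Definition ps_add F G : ps := PowerSeries (fun a => coef F a + coef G a).
Definition ps_const (c : C) : ps :=
  PowerSeries (fun a => if a == mi0 then c else 0).
(* The range of this sum is finite (see midecompE), so that this is the
   Cauchy product. *)
Definition ps_mul F G : ps := PowerSeries (fun g =>
  \sum_(ab \in [set ab : multi_index * multi_index | miadd ab.1 ab.2 = g])
     coef F ab.1 * coef G ab.2).

Lemma ps_addA : associative ps_add.
Proof. by move=> F G H; apply/psP => a /=; rewrite addrA. Qed.
Lemma ps_addC : commutative ps_add.
Proof. by move=> F G; apply/psP => a /=; rewrite addrC. Qed.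
Lemma ps_add0 : left_id ps_zero ps_add.
Proof. by move=> F; apply/psP => a /=; rewrite add0r. Qed.
Lemma ps_addN : left_inverse ps_zero ps_opp ps_add.
Proof. by move=> F; apply/psP => a /=; rewrite addNr. Qed.

HB.instance Definition _ :=
  GRing.isZmodule.Build ps ps_addA ps_addC ps_add0 ps_addN.

Lemma coef_ps_mul F G g :
  coef (ps_mul F G) g = \sum_(ab <- midecomp g) coef F ab.1 * coef G ab.2.
Proof. by rewrite /= midecompE -fsbig_seq// midecomp_uniq. Qed.

Lemma ps_mul_seq F G g (r : seq multi_index) :
  uniq r -> {subset midivs g <= r} ->
  coef (ps_mul F G) g = \sum_(a <- r) \sum_(b <- r)
    coef F a * coef G b * (miadd a b == g)%:R.
Proof. by move=> ur rg; rewrite coef_ps_mul (midecomp_sum _ ur rg). Qed.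

Lemma ps_mulC : commutative ps_mul.
Proof.
move=> F G; apply/psP => g.
rewrite !(@ps_mul_seq _ _ g (midivs g)) ?midivs_uniq// exchange_big /=.
apply: eq_bigr => a _; apply: eq_bigr => b _.
by rewrite miaddC [coef F b * _]mulrC.
Qed.

Lemma ps_mul_triple F G H g : coef (ps_mul (ps_mul F G) H) g =
  \sum_(a <- midivs g) \sum_(b <- midivs g) \sum_(c <- midivs g)
    coef F a * coef G b * coef H c * (miadd (miadd a b) c == g)%:R.
Proof.
set r := midivs g.
have ur : uniq r by exact: midivs_uniq.
rewrite (@ps_mul_seq _ _ g r)//.
under eq_big_seq => d dr.
  under eq_bigr => c _.
    rewrite (@ps_mul_seq _ _ d r)//; last first.
      move=> e /midivsP[e' ed]; have [d' dg] := midivsP dr.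
      by apply: mem_midivs; rewrite -dg -ed -miaddA; exact: mile_addl.
    rewrite -mulrA big_distrl /=.
    under eq_bigr do rewrite big_distrl /=.
    over.
  rewrite exchange_big /=; under eq_bigr do rewrite exchange_big /=.
  over.
rewrite exchange_big /=; apply: eq_bigr => a _.
rewrite exchange_big /=; apply: eq_bigr => b _.
rewrite exchange_big /=; apply: eq_bigr => c _.
have [abc|abc] := eqVneq (miadd (miadd a b) c) g; last first.
  rewrite mulr0 big1// => d _.
  have [abd|] := eqVneq (miadd a b) d; last by rewrite mulr0 mul0r.
  by rewrite -abd (negbTE abc) !mulr0.
have abr : miadd a b \in r by apply: mem_midivs; rewrite -abc; exact: mile_addl.
rewrite (bigD1_seq (miadd a b))//= eqxx abc eqxx !mulr1 big1 ?addr0// => d dab.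
by rewrite eq_sym (negbTE dab) mulr0 mul0r.
Qed.

Lemma ps_mulA : associative ps_mul.
Proof.
move=> F G H; apply/psP => g; rewrite [ps_mul F _]ps_mulC !ps_mul_triple.
rewrite [RHS]exchange_big; apply: eq_bigr => b _.
rewrite [RHS]exchange_big; apply: eq_bigr => c _; apply: eq_bigr => a _ /=.
have -> : miadd (miadd b c) a = miadd (miadd a b) c by rewrite miaddC miaddA.
by congr (_ * _); rewrite mulrC mulrA.
Qed.

Lemma ps_mul1 : left_id (ps_const 1) ps_mul.
Proof.
move=> F; apply/psP => g.
have gr : g \in midivs g by apply: mem_midivs => j.
have r0 : mi0 \in midivs g by apply: mem_midivs => j; rewrite mi0E.
rewrite (@ps_mul_seq _ _ g (midivs g)) ?midivs_uniq//.
rewrite (bigD1_seq mi0) ?midivs_uniq//= eqxx [X in _ + X]big1 ?addr0; last first.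
  by move=> a /negbTE a0; rewrite big1// => b _; rewrite a0 !mul0r.
rewrite (bigD1_seq g) ?midivs_uniq//= big1 ?addr0; last first.
  by move=> b /negbTE bg; rewrite mi0add bg mulr0.
by rewrite mi0add eqxx mul1r mulr1.
Qed.

Lemma ps_mulDl : left_distributive ps_mul ps_add.
Proof.
move=> F G H; apply/psP => g.
rewrite [RHS]/(coef (ps_mul F H) g + coef (ps_mul G H) g) !coef_ps_mul.
transitivity (\sum_(ab <- midecomp g)
  (coef F ab.1 * coef H ab.2 + coef G ab.1 * coef H ab.2)).
  by apply: eq_bigr => ab _; rewrite -mulrDl.
exact: big_split.
Qed.

Lemma ps_oner_neq0 : ps_const 1 != ps_zero.
Proof. by apply/eqP => /psP/(_ mi0)/= /eqP; rewrite eqxx oner_eq0. Qed.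

HB.instance Definition _ := GRing.Zmodule_isComNzRing.Build ps
  ps_mulA ps_mulC ps_mul1 ps_mulDl ps_oner_neq0.

End PowerSeriesRing.

(* (2N)^(c a), in the 0-based indexing of [multi_index] *)
Definition twoN (R : realType) (c : int) (a : multi_index) : R :=
  \prod_(j <- finsupp a) (2 * j.+1)%:R ^ (c * (a j)%:Z).


Section TwoN.
Variable R : realType.
Implicit Types (c d : int) (a b : multi_index).

Lemma two_pos (j : nat) : 0 < (2 * j.+1)%:R :> R.
Proof. by rewrite ltr0n muln_gt0. Qed.

Lemma two_neq0 (j : nat) : (2 * j.+1)%:R != 0 :> R.
Proof. by rewrite gt_eqF ?two_pos. Qed.

Lemma twoN_gt0 c a : 0 < twoN R c a.
Proof. by apply: prodr_gt0 => j _; rewrite exprz_gt0 ?two_pos. Qed.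

Lemma twoN_ge0 c a : 0 <= twoN R c a.
Proof. exact/ltW/twoN_gt0. Qed.

Lemma twoND c d a : twoN R (c + d) a = twoN R c a * twoN R d a.
Proof.
rewrite /twoN -big_split /=; apply: eq_bigr => j _.
by rewrite mulrDl expfzDr ?two_neq0.
Qed.

Lemma twoNE c a (X : {fset nat}) : (finsupp a `<=` X)%fset ->
  twoN R c a = \prod_(j <- X) (2 * j.+1)%:R ^ (c * (a j)%:Z).
Proof.
move=> aX; apply: big_fset_incl => // j _ ja.
by rewrite fsfun_dflt// mulr0.
Qed.

Lemma twoN_add c a b : twoN R c (miadd a b) = twoN R c a * twoN R c b.
Proof.
pose X := (finsupp a `|` finsupp b)%fset.
rewrite (@twoNE _ a X) ?fsubsetUl// (@twoNE _ b X) ?fsubsetUr//.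
rewrite (@twoNE _ _ X); last first.
  apply/fsubsetP => j; rewrite inE !mem_finsupp miaddE.
  by apply: contraNT; rewrite negb_or !negbK => /andP[/eqP -> /eqP ->].
rewrite -big_split; apply: eq_bigr => j _ /=.
by rewrite miaddE PoszD mulrDr expfzDr ?two_neq0.
Qed.

Lemma twoN0 c : twoN R c mi0 = 1.
Proof. by rewrite /twoN big1// => j _; rewrite mi0E mulr0. Qed.

Lemma twoN_le_size g : (size (midivs g))%:R <= twoN R 1 g.
Proof.
apply: (le_trans (y := (\prod_(j <- finsupp g) (g j).+1)%N%:R)).
  by rewrite ler_nat size_midivs.
rewrite natr_prod; apply: ler_prod => j _; rewrite ler0n mul1r /=.
rewrite -exprnP -natrX ler_nat.
apply: (leq_trans (ltn_expl (g j) (isT : (1 < 2)%N))).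
by case: (g j) => // n; rewrite leq_exp2r// mulnS leq_addr.
Qed.

Lemma twoN_anti (k l : nat) g : (k <= l)%N -> twoN R (- l%:Z) g <= twoN R (- k%:Z) g.
Proof.
move=> kl; apply: ler_prod => j _; rewrite exprz_ge0 ?(ltW (two_pos _))//=.
apply: ler_weXz2l; last first.
  by rewrite !mulNr lerN2 ler_wpM2r.
by rewrite ler1n muln_gt0.
Qed.

End TwoN.

Lemma sum_sqr_le (R : realType) (T : Type) (s : seq T) (x : T -> R) :
  (\sum_(i <- s) x i) ^+ 2 <= (size s)%:R * \sum_(i <- s) x i ^+ 2.
Proof.
elim: s => [|i s IH]; first by rewrite !big_nil expr0n mul0r.
rewrite !big_cons /=; set S := \sum_(_ <- _) _ in IH *.
set Q := \sum_(_ <- _) _ in IH *.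
have : 2 * x i * S <= (size s)%:R * x i ^+ 2 + Q.
  rewrite /S /Q; elim: (s) => [|j t IHt].
    by rewrite !big_nil mulr0 mul0r addr0.
  rewrite !big_cons /= -natr1; have := sqr_ge0 (x i - x j); nra.
rewrite -natr1; nra.
Qed.

Section Kondratiev.
Variable R : realType.
Local Notation C := R[i].
Local Notation ps := (power_series R).

(* The formal series sum_a f_a H_a, encoded by its coefficients f_a. *)
Definition chaos := multi_index -> C.

Definition hnorm (k : nat) (f : chaos) : \bar R :=
  sqrte (\esum_(a in [set: multi_index])
           (normc (f a) ^+ 2 * twoN R (- k%:Z) a)%:E).

Definition hilbert (k : nat) : set chaos := [set f | (hnorm k f < +oo)%E].

Definition kondratiev : set chaos :=
  \bigcup_(k in [set k | (0 < k)%N]) hilbert k.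

Lemma hilbertP k f : hilbert k f <->
  exists M : R, forall s : seq multi_index, uniq s ->
    \sum_(a <- s) normc (f a) ^+ 2 * twoN R (- k%:Z) a <= M.
Proof.
pose phi a := normc (f a) ^+ 2 * twoN R (- k%:Z) a; rewrite -/phi.
have phi_ge0 a : 0 <= phi a by rewrite mulr_ge0 ?sqr_ge0 ?twoN_ge0.
have -> : hilbert k f <-> (\esum_(a in [set: multi_index]) (phi a)%:E < +oo)%E.
  rewrite /hilbert /hnorm /=; set E := esum _ _.
  by case: E => [r||] //=; rewrite ?ltry.
split=> [Eoo|[M sM]].
  exists (fine (\esum_(a in [set: multi_index]) (phi a)%:E)) => s us.
  rewrite -lee_fin fineK; last first.
    by rewrite ge0_fin_numE// esum_ge0// => a _; rewrite lee_fin.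
  apply: esum_ge; exists [set` s]; first by split => //; exact: finite_seq.
  by rewrite -fsbig_seq// -sumEFin lexx.
apply: (le_lt_trans _ (ltry M)); apply: ge_ereal_sup => _ [X [finX _] <-].
have /finite_seqP[s ->] := finX.
have -> : [set` s] = [set` undup s].
  by apply/seteqP; split => a /=; rewrite mem_undup.
by rewrite -fsbig_seq ?undup_uniq// sumEFin lee_fin sM ?undup_uniq.
Qed.

Lemma hilbert_le k l f : (k <= l)%N -> hilbert k f -> hilbert l f.
Proof.
move=> kl /hilbertP[M fM]; apply/hilbertP; exists M => s us.
apply: le_trans (fM s us); apply: ler_sum => a _.
by rewrite ler_wpM2l ?sqr_ge0// twoN_anti.
Qed.

Lemma normc_ge0 (z : C) : 0 <= normc z.
Proof. by case: z => x y; exact: sqrtr_ge0. Qed.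

Lemma normc_sum (T : Type) (s : seq T) (z : T -> C) :
  normc (\sum_(i <- s) z i) <= \sum_(i <- s) normc (z i).
Proof.
elim: s => [|i s IH]; first by rewrite !big_nil ComplexField.Normc.normc0.
by rewrite !big_cons (le_trans (le_normcD _ _))// lerD2l.
Qed.

Lemma hilbert_const k c : hilbert k (coef (ps_const c)).
Proof.
apply/hilbertP; exists (normc c ^+ 2) => s us.
have [s0|s0] := boolP (mi0 \in s).
  rewrite (bigD1_seq mi0)//= eqxx twoN0 mulr1 big1 ?addr0// => a /negbTE ->.
  by rewrite ComplexField.Normc.normc0 expr0n mul0r.
rewrite big1_seq ?sqr_ge0// => a /= sa.
rewrite ifF ?ComplexField.Normc.normc0 ?expr0n ?mul0r//.
by apply: contraNF s0 => /eqP <-.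
Qed.

Lemma hilbertB k (F G : ps) :
  hilbert k (coef F) -> hilbert k (coef G) -> hilbert k (coef (F - G)).
Proof.
move=> /hilbertP[M FM] /hilbertP[N GN]; apply/hilbertP.
exists (2 * M + 2 * N) => s us.
apply: (le_trans (y := 2 * (\sum_(a <- s) normc (coef F a) ^+ 2 * twoN R (- k%:Z) a)
  + 2 * (\sum_(a <- s) normc (coef G a) ^+ 2 * twoN R (- k%:Z) a))); last first.
  by rewrite lerD// ler_wpM2l// ?FM ?GN.
rewrite !mulr_sumr -big_split; apply: ler_sum => a _ /=.
rewrite !mulrA -mulrDl ler_wpM2r ?twoN_ge0//.
have := le_normcD (coef F a) (- coef G a); rewrite normcN => FG.
have F0 := normc_ge0 (coef F a); have G0 := normc_ge0 (coef G a).
have FG0 := normc_ge0 (coef F a - coef G a).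
apply: (le_trans (y := (normc (coef F a) + normc (coef G a)) ^+ 2)).
  by rewrite ler_sqr ?nnegrE ?addr_ge0.
have := sqr_ge0 (normc (coef F a) - normc (coef G a)); nra.
Qed.

Lemma hilbertM k (F G : ps) :
  hilbert k (coef F) -> hilbert k (coef G) -> hilbert k.+1 (coef (F * G)).
Proof.
move=> /hilbertP[M FM] /hilbertP[N GN]; apply/hilbertP.
pose phi (F : ps) a := normc (coef F a) ^+ 2 * twoN R (- k%:Z) a.
have phi_ge0 H a : 0 <= phi H a by rewrite mulr_ge0 ?sqr_ge0 ?twoN_ge0.
exists (M * N) => s us; pose r := undup (flatten [seq midivs g | g <- s]).
have ur : uniq r by exact: undup_uniq.
have sr g : g \in s -> {subset midivs g <= r}.
  move=> gs a ag; rewrite mem_undup; apply/flattenP; exists (midivs g) => //.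
  exact: map_f.
apply: (@le_trans _ _ (\sum_(g <- s) \sum_(ab <- midecomp g) phi F ab.1 * phi G ab.2)).
  apply: ler_sum => g _; rewrite coef_ps_mul.
  have -> : - k.+1%:Z = - 1%:Z - k%:Z by rewrite -addn1 PoszD opprD addrC.
  rewrite twoND mulrA.
  apply: (@le_trans _ _
    ((\sum_(ab <- midecomp g) (normc (coef F ab.1) * normc (coef G ab.2)) ^+ 2)
       * twoN R (- k%:Z) g)); last first.
    rewrite mulr_suml big_seq [leRHS]big_seq; apply: ler_sum => ab.
    rewrite mem_midecomp => /eqP <-; rewrite twoN_add /phi exprMn.
    by rewrite mulrACA.
  rewrite ler_wpM2r ?twoN_ge0//.
  rewrite -(@ler_pM2r _ (twoN R 1%:Z g)) ?twoN_gt0// -mulrA -twoND addNr.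
  have -> : twoN R 0 g = 1 by rewrite /twoN big1// => j _; rewrite mul0r.
  rewrite mulr1.
  apply: (@le_trans _ _ ((\sum_(ab <- midecomp g) normc (coef F ab.1) * normc (coef G ab.2)) ^+ 2)).
    rewrite ler_sqr ?nnegrE ?normc_ge0//; last first.
      by apply: sumr_ge0 => ab _; rewrite mulr_ge0 ?normc_ge0.
    apply: (le_trans (normc_sum _ _)); apply: ler_sum => ab _.
    by rewrite ComplexField.Normc.normcM.
  apply: (le_trans (sum_sqr_le _ _)); rewrite mulrC ler_wpM2l//.
    by apply: sumr_ge0 => ab _; rewrite sqr_ge0.
  by apply: le_trans (twoN_le_size _ g); rewrite ler_nat size_midecomp.
have -> : \sum_(g <- s) \sum_(ab <- midecomp g) phi F ab.1 * phi G ab.2 =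
    \sum_(a <- r) \sum_(b <- r) phi F a * phi G b *
       \sum_(g <- s) (miadd a b == g)%:R.
  under eq_big_seq => g gs do rewrite (midecomp_sum _ ur (sr g gs)).
  rewrite exchange_big; apply: eq_bigr => a _.
  by rewrite exchange_big; apply: eq_bigr => b _ /=; rewrite mulr_sumr.
apply: (@le_trans _ _ ((\sum_(a <- r) phi F a) * \sum_(b <- r) phi G b)).
  rewrite mulr_suml; apply: ler_sum => a _; rewrite mulr_sumr.
  apply: ler_sum => b _; apply: ler_piMr; first exact: mulr_ge0.
  rewrite -natr_sum lern1.
  rewrite (_ : (\sum_(g <- s) _)%N = count_mem (miadd a b) s).
    by rewrite count_uniq_mem// leq_b1.
  rewrite -sum1_count [RHS]big_mkcond; apply: eq_bigr => g _ /=.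
  by rewrite eq_sym; case: eqP.
by apply: ler_pM; rewrite ?sumr_ge0// ?FM ?GN.
Qed.

(* The absolutely convex subsets of the Kondratiev space whose trace on each
   Hilbert space [hilbert k] is a neighbourhood of 0 in it: a base of
   neighbourhoods of 0 for the locally convex inductive limit topology. *)
Definition kondratiev_nbhs0 (U : set chaos) : Prop :=
  [/\ U `<=` kondratiev,
      forall (s t : C) (f g : chaos), normc s + normc t <= 1 -> U f -> U g ->
        U (fun a => s * f a + t * g a) &
      forall k, (0 < k)%N -> exists2 e : R, 0 < e &
        forall f, (hnorm k f < e%:E)%E -> U f].

Definition kondratiev_cvg (u : nat -> chaos) (f : chaos) : Prop :=
  forall U, kondratiev_nbhs0 U ->
    \forall n \near \oo, U (fun a => u n a - f a).

(* The Hermite transform: sum_a f_a H_a is sent to sum_a f_a z^a. *)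
Definition hermite (f : chaos) : ps := PowerSeries f.

Definition frakR_pred : {pred ps} := mem (hermite @` kondratiev).

Lemma frakR_predP (F : ps) :
  F \in frakR_pred <-> exists2 k, (0 < k)%N & hilbert k (coef F).
Proof.
rewrite /frakR_pred; split => [/set_mem[f [k k0 fk] <-]|[k k0 Fk]].
  by exists k.
by apply: mem_set; exists (coef F); [exists k | case: F {Fk}].
Qed.

Lemma frakR_const c : ps_const c \in frakR_pred.
Proof. by apply/frakR_predP; exists 1%N => //; exact: hilbert_const. Qed.

Lemma frakR_subring_closed : subring_closed frakR_pred.
Proof.
split=> [|F G /frakR_predP[k k0 Fk] /frakR_predP[l l0 Gl]|
         F G /frakR_predP[k k0 Fk] /frakR_predP[l l0 Gl]].
- exact: frakR_const.
- apply/frakR_predP; exists (maxn k l); first by rewrite leq_max k0.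
  by apply: hilbertB; [apply: hilbert_le Fk|apply: hilbert_le Gl];
    rewrite leq_max leqnn ?orbT.
- apply/frakR_predP; exists (maxn k l).+1 => //.
  by apply: hilbertM; [apply: hilbert_le Fk|apply: hilbert_le Gl];
    rewrite leq_max leqnn ?orbT.
Qed.

HB.instance Definition _ :=
  GRing.isSubringClosed.Build ps frakR_pred frakR_subring_closed.

(* The ring of the Hermite transforms of the elements of the Kondratiev space,
   a subring of the ring of formal power series in z. *)
Record frakR := FrakR { frakR_ps : ps; _ : frakR_ps \in frakR_pred }.

HB.instance Definition _ := [isSub for frakR_ps].
HB.instance Definition _ := [Choice of frakR by <:].
HB.instance Definition _ := [SubChoice_isSubComNzRing of frakR by <:].

Definition frakR_cst (c : C) : frakR := FrakR (frakR_const c).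

Definition inv_hermite (F : frakR) : chaos := coef (frakR_ps F).

Definition frakR_cvg (u : nat -> frakR) (F : frakR) : Prop :=
  kondratiev_cvg (fun n => inv_hermite (u n)) (inv_hermite F).

(* Convergence of the series sum_n zeta^n H_n for all complex zeta close to 0. *)
Definition converges_near0 (p q : nat) (H : nat -> 'M[frakR]_(p, q)) : Prop :=
  exists2 e : R, 0 < e &
    forall zeta : C, normc zeta < e ->
      exists S : 'M[frakR]_(p, q), forall i j,
        frakR_cvg
          (fun m => (\sum_(n < m) frakR_cst zeta ^+ n *: H n) i j) (S i j).

End Kondratiev.

(* A power series in zeta is encoded by the sequence of its coefficients. *)
Definition zeta_mul (V : zmodType) (f : nat -> V) : nat -> V :=
  fun n => if n is m.+1 then f m else 0.

(* R_0 f = (f - f(0)) / zeta *)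
Definition R0 (V : Type) (f : nat -> V) : nat -> V := fun n => f n.+1.
Arguments R0 {V} f n.

Section ZetaSeries.
Variable K : comNzRingType.

Definition series_mul (f g : nat -> K) : nat -> K :=
  fun n => \sum_(i < n.+1) f i * g (n - i)%N.

(* In [zeta_rational_div], [f] is the quotient of [g] by [h]. *)
Inductive zeta_rational : (nat -> K) -> Prop :=
| zeta_rational_poly (P : {poly K}) (f : nat -> K) :
    (forall n, f n = P`_n) -> zeta_rational f
| zeta_rational_add (f g h : nat -> K) : zeta_rational g -> zeta_rational h ->
    (forall n, f n = g n + h n) -> zeta_rational f
| zeta_rational_mul (f g h : nat -> K) : zeta_rational g -> zeta_rational h ->
    (forall n, f n = series_mul g h n) -> zeta_rational f
| zeta_rational_div (f g h : nat -> K) : zeta_rational g -> zeta_rational h ->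
    (exists u, h 0%N * u = 1) ->
    (forall n, series_mul f h n = g n) -> zeta_rational f.

(* (I - zeta A)^-1 *)
Definition resolvent (N : nat) (A : 'M[K]_N) : nat -> 'M[K]_N :=
  fun n => A ^+ n.

(* D + zeta C (I - zeta A)^-1 B *)
Definition realization (N p q : nat) (A : 'M[K]_N) (B : 'M[K]_(N, q))
    (C : 'M[K]_(p, N)) (D : 'M[K]_(p, q)) : nat -> 'M[K]_(p, q) :=
  fun n => (if n == 0%N then D else 0)
           + zeta_mul (fun m => C *m resolvent A m *m B) n.

End ZetaSeries.

(* Main.v *)
Require Import Defs.
From HB Require Import structures.
From mathcomp Require Import all_boot all_order all_algebra.
From mathcomp Require Import finmap.
From mathcomp Require Import boolp classical_sets functions cardinality fsbigop.
From mathcomp Require Import reals ereal esum topology.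
From mathcomp Require Import complex.
From mathcomp Require Import zify ring lra.

(** The equivalence is the classical description of rational transfer functions,
    valid over any commutative ring [K], completed by one analytic fact about
    the ring [frakR] of Hermite transforms.

    Rational implies realizable. The quotients [P / Q] of polynomials with
    [Q(0) = 1] are closed under sums, products and admissible divisions
    ([zeta_rational_fraction]), and finitely many of them have a common
    denominator of the same kind. Read coefficientwise, [Q H = P] says that the
    [H n] eventually satisfy a linear recurrence with coefficients in [K]
    ([fraction_recurrence]), and a recurrence is realized by its companion
    matrix acting on windows of consecutive values
    ([realization_of_recurrence]).

    Realizable implies spanned. For [n > 0] the series [R0^n H] is
    [C A^(n-1) (I - zeta A)^-1 B], and by the Cayley-Hamilton theorem the powers
    of [A] are combinations of the first [N] ones ([R0_span_of_realization]).

    Spanned implies rational. A single relation [R0^M H = \sum_j c_j R0^j H] is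
    a linear recurrence, so that multiplication by the reversed characteristic
    polynomial turns the entries of [H] into polynomials
    ([rational_of_R0_span]).

    Realizable implies convergent. What is needed is a geometric bound for
    [zeta^n C A^(n-1) B], hence a norm that is submultiplicative. The Hilbert
    norms are not, as a product costs a change of weight; but the weighted l1
    norm [\sum_a |f_a| (2N)^(-k a)] is ([l1_boundM]). Every element of [frakR]
    has a finite l1 norm for [k] large, and pointwise geometric bounds lead back
    to a Hilbert norm with a larger index, both because
    [\sum_a (2N)^(-2 a)] is finite ([sum_twoN_le2]). This is the Euler product
    of the factors [1 / (1 - (2j)^-2)], that is, the Wallis product. *)

Set Implicit Arguments.
Unset Strict Implicit.
Unset Printing Implicit Defensive.

Import Order.TTheory GRing.Theory Num.Theory.

Local Open Scope ring_scope.

(** * The ring of formal power series in zeta *)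

(** A wrapper around [nat -> K], which keeps the Cauchy product apart from the
    pointwise product of functions. *)
Record zeta_series (K : Type) := ZetaSeries { zcoef : nat -> K }.

Section ZetaSeriesRing.
Variable K : comNzRingType.
Local Notation ser := (zeta_series K).
Implicit Types (f g h : ser).

HB.instance Definition _ := gen_eqMixin ser.
HB.instance Definition _ := gen_choiceMixin ser.

Lemma zeta_seriesP f g : (forall n, zcoef f n = zcoef g n) <-> f = g.
Proof.
by split=> [|-> //]; case: f g => f [g] /= fg; congr ZetaSeries; apply/funext.
Qed.

Definition zs_poly (P : {poly K}) : ser := ZetaSeries (fun n => P`_n).
Definition zs_opp f : ser := ZetaSeries (fun n => - zcoef f n).
Definition zs_add f g : ser := ZetaSeries (fun n => zcoef f n + zcoef g n).
Definition zs_mul f g : ser := ZetaSeries (series_mul (zcoef f) (zcoef g)).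

Definition zs_trunc n f : {poly K} := \poly_(i < n.+1) zcoef f i.

Lemma coef_zs_trunc n f i : (i <= n)%N -> (zs_trunc n f)`_i = zcoef f i.
Proof. by move=> le_in; rewrite coef_poly ltnS le_in. Qed.

(** Every law of the Cauchy product only involves finitely many coefficients
    at a time, so that it can be read off the ring of polynomials. *)
Lemma zs_mul_trunc n f g i : (i <= n)%N ->
  zcoef (zs_mul f g) i = (zs_trunc n f * zs_trunc n g)`_i.
Proof.
move=> le_in; rewrite coefM; apply: eq_bigr => j _.
have le_ji : (j <= i)%N by rewrite -ltnS.
by rewrite !coef_zs_trunc// (leq_trans _ le_in)// leq_subr.
Qed.

Lemma zs_addA : associative zs_add.
Proof. by move=> f g h; apply/zeta_seriesP => n /=; rewrite addrA. Qed.
Lemma zs_addC : commutative zs_add.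
Proof. by move=> f g; apply/zeta_seriesP => n /=; rewrite addrC. Qed.
Lemma zs_add0 : left_id (zs_poly 0) zs_add.
Proof. by move=> f; apply/zeta_seriesP => n /=; rewrite coef0 add0r. Qed.
Lemma zs_addN : left_inverse (zs_poly 0) zs_opp zs_add.
Proof. by move=> f; apply/zeta_seriesP => n /=; rewrite coef0 addNr. Qed.

HB.instance Definition _ :=
  GRing.isZmodule.Build ser zs_addA zs_addC zs_add0 zs_addN.

Lemma zs_mulC : commutative zs_mul.
Proof.
by move=> f g; apply/zeta_seriesP => n; rewrite !(zs_mul_trunc _ _ (leqnn n)) mulrC.
Qed.

Lemma zs_mulA : associative zs_mul.
Proof.
move=> f g h; apply/zeta_seriesP => n.
have trM u v i : (i <= n)%N ->
    (zs_trunc n (zs_mul u v))`_i = (zs_trunc n u * zs_trunc n v)`_i.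
  by move=> le_in; rewrite coef_zs_trunc// (zs_mul_trunc _ _ le_in).
rewrite !(zs_mul_trunc _ _ (leqnn n)).
transitivity (zs_trunc n f * zs_trunc n g * zs_trunc n h)`_n.
  rewrite -mulrA coefM [RHS]coefM; apply: eq_bigr => i _.
  by rewrite trM ?leq_subr.
rewrite coefM [RHS]coefM; apply: eq_bigr => i _.
by rewrite trM// -ltnS.
Qed.

Lemma zs_mul1 : left_id (zs_poly 1) zs_mul.
Proof.
move=> f; apply/zeta_seriesP => n; rewrite (zs_mul_trunc _ _ (leqnn n)).
have -> : zs_trunc n (zs_poly 1) = 1.
  apply/polyP => i; rewrite coef_poly /= coefC.
  by case: i => [|i] //=; rewrite if_same.
by rewrite mul1r coef_zs_trunc.
Qed.

Lemma zs_mulDl : left_distributive zs_mul zs_add.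
Proof.
move=> f g h; apply/zeta_seriesP => n /=; rewrite /series_mul -big_split /=.
by apply: eq_bigr => i _; rewrite mulrDl.
Qed.

Lemma zs_one_neq0 : zs_poly 1 != zs_poly 0.
Proof.
by apply/eqP => /zeta_seriesP/(_ 0%N)/= /eqP; rewrite coef1 coef0 oner_eq0.
Qed.

HB.instance Definition _ := GRing.Zmodule_isComNzRing.Build ser
  zs_mulA zs_mulC zs_mul1 zs_mulDl zs_one_neq0.

Lemma zs_polyD (P Q : {poly K}) : zs_poly (P + Q) = zs_poly P + zs_poly Q.
Proof. by apply/zeta_seriesP => n /=; rewrite coefD. Qed.

Lemma zs_polyM (P Q : {poly K}) : zs_poly (P * Q) = zs_poly P * zs_poly Q.
Proof. by apply/zeta_seriesP => n /=; rewrite coefM. Qed.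

(** * Fractions, recurrences and realizations *)

Definition zeta_fraction (a : nat -> K) : Prop :=
  exists P Q : {poly K}, Q`_0 = 1 /\ ZetaSeries a * zs_poly Q = zs_poly P.

(** The normalization [Q(0) = 1] is kept by products of denominators; in a
    division the constant coefficient of the new denominator is the one of the
    divisor, which is where its invertibility is used. *)
Lemma zeta_rational_fraction (a : nat -> K) : zeta_rational a -> zeta_fraction a.
Proof.
elim=> {a} [P f fP|f g h _ [P1 [Q1 [Q10 gE]]] _ [P2 [Q2 [Q20 hE]]] fE
           |f g h _ [P1 [Q1 [Q10 gE]]] _ [P2 [Q2 [Q20 hE]]] fE
           |f g h _ [P1 [Q1 [Q10 gE]]] _ [P2 [Q2 [Q20 hE]]] [u hu] fE].
- exists P, 1; split; first by rewrite coef1.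
  by rewrite mulr1; apply/zeta_seriesP.
- exists (P1 * Q2 + P2 * Q1), (Q1 * Q2); split.
    by rewrite coefM big_ord1 Q10 Q20 mulr1.
  have -> : ZetaSeries f = ZetaSeries g + ZetaSeries h by apply/zeta_seriesP.
  rewrite zs_polyD !zs_polyM -gE -hE; ring.
- exists (P1 * P2), (Q1 * Q2); split.
    by rewrite coefM big_ord1 Q10 Q20 mulr1.
  have -> : ZetaSeries f = ZetaSeries g * ZetaSeries h by apply/zeta_seriesP.
  rewrite !zs_polyM -gE -hE; ring.
(* The denominator P2 * Q1 has the constant coefficient h 0 of the divisor;
   its inverse u normalizes it to 1. *)
- have P20 : P2`_0 = h 0%N.
    move/zeta_seriesP/(_ 0%N): hE => /= <-.
    by rewrite /series_mul big_ord1 /= Q20 mulr1.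
  exists (u%:P * P1 * Q2), (u%:P * P2 * Q1); split.
    by rewrite coefM big_ord1 coefCM Q10 mulr1 P20 mulrC.
  have gfh : ZetaSeries g = ZetaSeries f * ZetaSeries h.
    by apply/zeta_seriesP => n /=.
  rewrite !zs_polyM -gE -hE gfh; ring.
Qed.

Lemma zeta_fraction_common_denominator (I : finType) (f : I -> nat -> K) :
  (forall i, zeta_fraction (f i)) ->
  exists (Q : {poly K}) (P : I -> {poly K}), Q`_0 = 1 /\
    forall i, ZetaSeries (f i) * zs_poly Q = zs_poly (P i).
Proof.
move=> fF; have [P PF] := choice fF; have [Q QF] := choice PF.
exists (\prod_i Q i), (fun i => P i * \prod_(j | j != i) Q j); split.
  elim/big_rec: _ => [|i A _ A0]; first by rewrite coef1.
  by rewrite coefM big_ord1 A0 mulr1; case: (QF i).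
move=> i; rewrite (bigD1 i)//= !zs_polyM mulrA.
by case: (QF i) => _ ->.
Qed.

(** Beyond the degree of [P], the coefficients of [Q f] vanish; since
    [Q(0) = 1], this determines each value of [f] from the [L] previous ones. *)
Lemma fraction_recurrence (f : nat -> K) (P Q : {poly K}) (L m : nat) :
  Q`_0 = 1 -> ZetaSeries f * zs_poly Q = zs_poly P ->
  (size Q <= L.+1)%N -> (size P <= L + m)%N ->
  f (L + m)%N = \sum_(k < L) (- Q`_(L - k)) * f (m + k)%N.
Proof.
move=> Q0 fQ sQ sP.
have := (zeta_seriesP _ _).2 fQ (L + m)%N; rewrite /= /series_mul nth_default//.
rewrite big_ord_recr /= subnn Q0 mulr1 => /eqP; rewrite addrC addr_eq0 => /eqP ->.
rewrite -(big_mkord xpredT (fun i => f i * Q`_(L + m - i))).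
rewrite (@big_cat_nat _ _ _ m)//=.
  (* The terms of index i < m involve coefficients of Q beyond its degree. *)
  rewrite [X in X + _]big1_seq ?add0r; last first.
    move=> i /andP[_]; rewrite mem_index_iota => /andP[_ im].
    by rewrite [Q`__]nth_default ?mulr0// (leq_trans sQ)//; lia.
  rewrite -{1}[m]add0n big_addn addnK big_mkord -sumrN.
  by apply: eq_bigr => k _; rewrite subnDr mulNr mulrC addnC.
exact: leq_addl.
Qed.

End ZetaSeriesRing.

Section Realization.
Variables (K : comNzRingType) (p q : nat).
Implicit Type H : nat -> 'M[K]_(p, q).

(** A realization amounts to a finite family of sequences stable under the
    shift up to linear combinations, from which the sequence itself is read by
    linear combinations. The family may be indexed by any finite type, which
    avoids block matrices. *)
Lemma realization_of_states (T : finType) (x : nat -> T -> 'rV[K]_q)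
    (a : T -> T -> K) (c : 'I_p -> T -> K) H :
  (forall n t, x n.+1 t = \sum_s a t s *: x n s) ->
  (forall n i, row i (H n.+1) = \sum_s c i s *: x n s) ->
  exists (N : nat) (A : 'M[K]_N) (B : 'M[K]_(N, q)) (C : 'M[K]_(p, N))
    (D : 'M[K]_(p, q)), forall n, H n = realization A B C D n.
Proof.
move=> xS Hx; pose e := @enum_val T predT.
pose A : 'M[K]_#|T| := \matrix_(i, j) a (e i) (e j).
pose B : 'M[K]_(#|T|, q) := \matrix_i x 0%N (e i).
pose C : 'M[K]_(p, #|T|) := \matrix_(i, j) c i (e j).
have sum_e (F : T -> 'rV[K]_q) : \sum_s F s = \sum_i F (e i).
  by rewrite (reindex e)//; apply: onW_bij; exact: enum_val_bij.
have xE n : \matrix_i x n (e i) = A ^+ n *m B.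
  elim: n => [|n IH]; first by rewrite expr0 mul1mx.
  rewrite exprS -mulmxE -mulmxA -IH; apply/row_matrixP => i.
  rewrite rowK xS sum_e row_mul mulmx_sum_row.
  by apply: eq_bigr => j _; rewrite rowK !mxE.
exists #|T|, A, B, C, (H 0%N) => -[|n]; rewrite /realization /= ?addr0// add0r.
rewrite /resolvent -mulmxA -xE; apply/row_matrixP => i.
rewrite Hx sum_e row_mul mulmx_sum_row.
by apply: eq_bigr => j _; rewrite rowK !mxE.
Qed.

(** The state of a sequence with a linear recurrence of order [L.+1] is the
    window of its next [L.+1] values, one copy for each row; the evolution is
    the companion matrix. The order is a successor so that the window contains
    the current value, which is the output. *)
Lemma realization_of_recurrence (L : nat) (b : nat -> K) H :
  (forall n, H (n.+1 + L.+1)%N = \sum_(k < L.+1) b k *: H (n.+1 + k)%N) ->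
  exists (N : nat) (A : 'M[K]_N) (B : 'M[K]_(N, q)) (C : 'M[K]_(p, N))
    (D : 'M[K]_(p, q)), forall n, H n = realization A B C D n.
Proof.
move=> HL; pose T : finType := ('I_p * 'I_L.+1)%type.
pose x n (t : T) := row t.1 (H (n.+1 + t.2)%N).
pose a (t s : T) : K := (t.1 == s.1)%:R *
  (if (t.2 < L)%N then (s.2 == t.2.+1 :> nat)%:R else b s.2).
pose c (i : 'I_p) (s : T) : K := (s == (i, ord0))%:R.
have pairE (i : 'I_p) (g : 'I_L.+1 -> K) (F : T -> 'rV[K]_q) :
    \sum_s ((i == s.1)%:R * g s.2) *: F s = \sum_k g k *: F (i, k).
  rewrite (eq_bigr (fun s : T => ((i == s.1)%:R * g s.2) *: F (s.1, s.2))).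
    rewrite -(pair_bigA _ (fun j k => ((i == j)%:R * g k) *: F (j, k))) /=.
    rewrite (bigD1 i)//= [X in _ + X]big1 ?addr0.
      by apply: eq_bigr => k _; rewrite eqxx mul1r.
    move=> j /negbTE ji; rewrite big1// => k _.
    by rewrite eq_sym ji mul0r scale0r.
  by case.
apply: (@realization_of_states T x a c) => [n [i k]|n i].
  have /= -> := pairE i (fun l : 'I_L.+1 =>
    if (k < L)%N then (l == k.+1 :> nat)%:R else b l) (x n).
  rewrite /x /=; case: ltnP => [ltkL|leLk].
    rewrite (bigD1 (Ordinal (ltkL : (k.+1 < L.+1)%N)))//= eqxx scale1r.
    rewrite big1 ?addr0 ?addSnnS// => j jk.
    rewrite (_ : (j == k.+1 :> nat) = false) ?scale0r//.
    by apply: contraNF jk => /eqP jk; apply/eqP/val_inj.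
  have -> : nat_of_ord k = L by apply/eqP; rewrite eqn_leq leLk -ltnS ltn_ord.
  rewrite addSnnS HL linear_sum /=; apply: eq_bigr => j _.
  by rewrite linearZ.
rewrite (bigD1 (i, ord0))//= /c eqxx scale1r big1 ?addr0 /x /= ?addn0// => s.
by move=> /negbTE ->; rewrite scale0r.
Qed.

Lemma realization_of_rational H :
  (forall i j, zeta_rational (fun n => H n i j)) ->
  exists (N : nat) (A : 'M[K]_N) (B : 'M[K]_(N, q)) (C : 'M[K]_(p, N))
    (D : 'M[K]_(p, q)), forall n, H n = realization A B C D n.
Proof.
move=> Hrat.
have [|Q [P [Q0 PQ]]] := @zeta_fraction_common_denominator K
    ('I_p * 'I_q)%type (fun ij n => H n ij.1 ij.2).
  by move=> [i j]; exact/zeta_rational_fraction/Hrat.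
pose L := maxn (size Q) (\max_ij size (P ij)).
apply: (@realization_of_recurrence L (fun k => - Q`_(L.+1 - k))) => n.
apply/matrixP => i j; rewrite summxE addnC.
rewrite (@fraction_recurrence _ (fun n => H n i j) (P (i, j)) Q)//.
- by apply: eq_bigr => k _; rewrite !mxE.
- exact: PQ (i, j).
- have : (size Q <= L)%N by rewrite leq_maxl.
  by lia.
- have : (size (P (i, j)) <= L)%N.
    rewrite (leq_trans _ (leq_maxr _ _))//.
    exact: (leq_bigmax (F := fun ij => size (P ij))).
  by lia.
Qed.

(** The power [A^n] is the value at [A] of the remainder of ['X^n] modulo the
    characteristic polynomial, which kills [A]. *)
Lemma expr_mx_span (N : nat) (A : 'M[K]_N) n :
  exists c : nat -> K, A ^+ n = \sum_(k < N) c k *: A ^+ k.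
Proof.
case: N A => [|N] A.
  by exists (fun=> 0); rewrite big_ord0; apply/matrixP => -[].
have chi_monic := char_poly_monic A.
pose r := Pdiv.CommonRing.rmodp 'X^n (char_poly A).
exists (fun k => r`_k).
have -> : A ^+ n = horner_mx A 'X^n by rewrite rmorphXn /= horner_mx_X.
rewrite [in LHS](Pdiv.RingMonic.rdivp_eq chi_monic 'X^n) -/r.
rewrite rmorphD rmorphM /= Cayley_Hamilton mulr0 add0r.
have sr : (size r <= N.+1)%N.
  rewrite -ltnS -(size_char_poly A) Pdiv.CommonRing.ltn_rmodp.
  exact: monic_neq0.
rewrite -[r in LHS](coefK r) (_ : \poly_(i < size r) r`_i = \poly_(i < N.+1) r`_i).
  rewrite poly_def linear_sum /=; apply: eq_bigr => k _.
  by rewrite linearZ /= rmorphXn /= horner_mx_X.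
apply/polyP => i; rewrite !coef_poly; case: (ltnP i (size r)) => [lt_ir|le_ri].
  by rewrite (leq_trans lt_ir sr).
by rewrite nth_default ?if_same.
Qed.

Lemma iter_R0 (V : Type) (h : nat -> V) n m : iter n R0 h m = h (m + n)%N.
Proof. by elim: n m => [|n IH] m; rewrite ?addn0// iterS /R0 IH addSnnS. Qed.

Lemma R0_span_of_realization N (A : 'M[K]_N) B C D H :
  (forall n, H n = realization A B C D n) ->
  forall n, (N.+1 <= n)%N -> exists c : nat -> K, forall m,
    iter n R0 H m = \sum_(1 <= j < N.+1) c j *: iter j R0 H m.
Proof.
move=> HE [//|n] _; have [c cE] := expr_mx_span A n.
exists (fun j => c j.-1) => m; rewrite big_add1 big_mkord iter_R0 HE addnS.
rewrite /realization /= add0r /resolvent exprD cE mulr_sumr mulmx_sumr mulmx_suml.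
apply: eq_bigr => k _; rewrite /R0 iter_R0 HE addSn.
rewrite /realization /= add0r /resolvent.
by rewrite -mulmxE -scalemxAr mulmxE -exprD -scalemxAr -scalemxAl.
Qed.

Lemma rational_of_R0_span H (M : nat) (c : nat -> K) :
  (forall m, iter M R0 H m = \sum_(1 <= j < M) c j *: iter j R0 H m) ->
  forall i j, zeta_rational (fun n => H n i j).
Proof.
move=> HM i j; pose f n := H n i j.
have fM m : f (m + M)%N = \sum_(1 <= k < M) c k * f (m + k)%N.
  rewrite /f -iter_R0 HM summxE; apply: eq_bigr => k _.
  by rewrite iter_R0 mxE.
(* [Q] is 1 - \sum_(1 <= k < M) c_k zeta^(M - k), the reversal of the
   characteristic polynomial of the recurrence. The recurrence starts at
   k = 1, so that the coefficient of zeta^M is not - c_0 but 0. *)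
pose Q : {poly K} := \poly_(k < M.+1)
  (if k == 0%N then 1 else if k == M then 0 else - c (M - k)%N).
have Q0 : Q`_0 = 1 by rewrite coef_poly.
have fQ m : series_mul f (fun k => Q`_k) (m + M)%N = 0.
  rewrite /series_mul big_ord_recr /= subnn Q0 mulr1 fM.
  rewrite -(big_mkord xpredT (fun i => f i * Q`_(m + M - i))).
  rewrite (@big_cat_nat _ _ _ m)//= ?leq_addr//.
  rewrite [X in X + _ + _]big1_seq ?add0r; last first.
    move=> k /andP[_]; rewrite mem_index_iota => /andP[_ km].
    by rewrite coef_poly ltnNge (_ : (M < _)%N) ?mulr0//; lia.
  rewrite -{1}[m]add0n big_addn addKn.
  case: M {HM} @Q Q0 fM => [|M] Q Q0 fM; first by rewrite !big_geq ?addr0.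
  rewrite big_ltn// add0n addKn [Q`__]coef_poly ltnSn /= eqxx mulr0 add0r.
  rewrite -big_split big1_seq//= => k; rewrite mem_index_iota => /andP[k0 kM].
  rewrite [(k + m)%N]addnC subnDl coef_poly ltnS leq_subr.
  rewrite subn_eq0 leqNgt kM /= ifF; last by apply/eqP; lia.
  by rewrite subKn 1?ltnW// mulrN mulrC addNr.
apply: (@zeta_rational_div _ f (series_mul f (fun k => Q`_k)) (fun k => Q`_k)) => //.
- apply: (@zeta_rational_poly _ (\poly_(n < M) series_mul f (fun k => Q`_k) n)) => n.
  rewrite coef_poly; case: ltnP => // Mn.
  by rewrite -(subnK Mn) fQ.
- exact: (@zeta_rational_poly _ Q).
- by exists 1; rewrite Q0 mulr1.
Qed.

End Realization.

(** * Summability of the weight (2N)^(-2 a) *)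

Lemma ler_sum_subset (R : numDomainType) (I : eqType) (s t : seq I) (F : I -> R) :
  uniq s -> uniq t -> {subset s <= t} -> (forall i, 0 <= F i) ->
  \sum_(i <- s) F i <= \sum_(i <- t) F i.
Proof.
move=> us ut st F0; rewrite (bigID [in s] xpredT)/= [leRHS](bigID [in s])/=.
rewrite [X in X + _ <= _]big_seq_cond [X in _ + X <= _]big1_seq; last first.
  by move=> i /andP[/negP].
rewrite -big_seq_cond addr0 -big_filter -[X in _ <= X + _]big_filter.
have /(perm_big _) -> : perm_eq [seq i <- s | i \in s] [seq i <- t | i \in s].
  apply: uniq_perm; rewrite ?filter_uniq// => i; rewrite !mem_filter.
  by case: (boolP (i \in s)) => //= /st ->.
by rewrite lerDl sumr_ge0.
Qed.

Section SummableWeights.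
Variable R : realType.

Lemma geometric_le (x : R) n : 0 <= x < 1 -> \sum_(i < n) x ^+ i <= (1 - x)^-1.
Proof.
move=> /andP[x0 x1]; have x1' : 0 < 1 - x by rewrite subr_gt0.
rewrite -(ler_pM2l x1') divff ?gt_eqF//.
rewrite -opprB mulNr -subrX1 opprB lerBlDr lerDl.
exact: exprn_ge0.
Qed.

(** The bound [2 - 1 / (n + 1)] is chosen so that it propagates by induction:
    with [m = n + 1], one has
    [(2 - 1/m) / (1 - (2m)^-2) = 2 - 2 / (2m + 1) <= 2 - 1 / (m + 1)]. *)
Lemma wallis_prod_le n :
  \prod_(j < n) (1 - ((2 * j.+1)%:R : R) ^- 2)^-1 <= 2 - n.+1%:R^-1.
Proof.
elim: n => [|n IH]; first by rewrite big_ord0 invr1; lra.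
rewrite big_ord_recr /=; set m : R := n.+1%:R.
have m1 : 1 <= m by rewrite ler1n.
have -> : (2 * n.+1)%:R = 2 * m by rewrite natrM.
have -> : n.+2%:R = m + 1 :> R by rewrite -natr1.
have fE : (1 - (2 * m) ^- 2)^-1 = 4 * m ^+ 2 / ((2 * m - 1) * (2 * m + 1)).
  by field; repeat (apply/andP; split); nra.
rewrite fE; apply: le_trans (ler_wpM2r _ IH) _.
  by rewrite divr_ge0 ?mulr_ge0 ?sqr_ge0//; lra.
have -> : (2 - m^-1) * (4 * m ^+ 2 / ((2 * m - 1) * (2 * m + 1))) =
    2 - 2 / (2 * m + 1).
  by field; repeat (apply/andP; split); nra.
rewrite lerD2l lerN2 ler_pdivlMr ?ler_pdivrMl; nra.
Qed.

Lemma multi_index_bounded (s : seq multi_index) :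
  exists B : nat, forall a, a \in s ->
    forall j, (a j <= B)%N /\ (j \in finsupp a -> j <= B)%N.
Proof.
(* A crude bound: a sum of naturals dominates each of its terms. *)
exists (\sum_(a <- s) \sum_(j <- finsupp a) (j + a j))%N => a sa j.
have [ja|ja] := boolP (j \in finsupp a); last by rewrite fsfun_dflt.
have : (j + a j <= \sum_(a <- s) \sum_(j <- finsupp a) (j + a j))%N.
  rewrite (big_rem a sa) /= (leq_trans _ (leq_addr _ _))//.
  by rewrite (big_rem j ja) /= leq_addr.
by split=> *; lia.
Qed.

(** A finite set of multi-indices lives in a box [{0..B}^(B+1)], over which the
    sum of the multiplicative weight factors into a product of geometric sums. *)
Lemma sum_twoN_le2 (s : seq multi_index) :
  uniq s -> \sum_(a <- s) twoN R (- 2%:Z) a <= 2.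
Proof.
move=> us; have [B sB] := multi_index_bounded s.
pose x j : R := ((2 * j.+1)%:R) ^- 2.
pose w (h : {ffun 'I_B.+1 -> 'I_B.+1}) : R := \prod_(j < B.+1) x j ^+ h j.
pose phi (a : multi_index) : {ffun 'I_B.+1 -> 'I_B.+1} :=
  [ffun j : 'I_B.+1 => inord (a j)].
have phiE a (j : 'I_B.+1) : a \in s -> phi a j = a j :> nat.
  by move=> sa; rewrite ffunE inordK// ltnS; case: (sB a sa j).
have x01 j : 0 <= x j < 1.
  rewrite invr_ge0 exprn_ge0//= invf_lt1 ?exprn_gt0 ?two_pos//.
  by rewrite exprn_egt1// ltr1n; lia.
have wE a : a \in s -> twoN R (- 2%:Z) a = w (phi a).
  move=> sa; pose X := seq_fset tt (iota 0 B.+1).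
  rewrite (@twoNE _ _ _ X); last first.
    apply/fsubsetP => j ja; rewrite seq_fsetE mem_iota /= add0n ltnS.
    by case: (sB a sa j) => _; exact.
  have pX : perm_eq X (iota 0 B.+1).
    by have := seq_fset_perm tt (iota 0 B.+1); rewrite undup_id// iota_uniq.
  rewrite (perm_big _ pX) /w /=.
  transitivity (\prod_(j < B.+1) x j ^+ a j); last first.
    by apply: eq_bigr => j _; rewrite phiE.
  rewrite -(big_mkord xpredT (fun j => x j ^+ a j)) /index_iota subn0.
  apply: eq_bigr => j _.
  by rewrite mulNr -exprz_inv -PoszM -exprnP exprM /x exprVn.
rewrite (eq_big_seq _ wE) -(big_map phi xpredT w).
apply: (@le_trans _ _ (\sum_h w h)).
  apply: ler_sum_subset; rewrite ?index_enum_uniq//.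
  - rewrite map_inj_in_uniq// => a b sa sb ab; apply/fsfunP => j.
    have [jB|jB] := ltnP j B.+1.
      by rewrite -(phiE a (Ordinal jB))// -(phiE b (Ordinal jB))// ab.
    rewrite !fsfun_dflt//; apply/negP => jab.
      by case: (sB b sb j) => _ /(_ jab); lia.
    by case: (sB a sa j) => _ /(_ jab); lia.
  - by move=> h _; rewrite mem_index_enum.
  - by move=> h; apply: prodr_ge0 => j _; rewrite exprn_ge0//; case/andP: (x01 j).
rewrite /w -(bigA_distr_bigA (fun j i : 'I_B.+1 => x j ^+ i)) /=.
apply: (@le_trans _ _ (\prod_(j < B.+1) (1 - x j)^-1)).
  apply: ler_prod => j _; rewrite geometric_le// andbT sumr_ge0// => i _.
  by rewrite exprn_ge0//; case/andP: (x01 j).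
apply: le_trans (wallis_prod_le _) _.
by rewrite lerBlDr lerDl invr_ge0.
Qed.

End SummableWeights.

(** * Weighted l1 norms *)

Section WeightedL1.
Variable R : realType.
Local Notation ps := (power_series R).
Implicit Types (F G : ps) (k : nat) (M N : R).

(** The norm is bounded rather than defined, through the finite partial sums, so
    that no summability has to be carried along. *)
Definition l1_bound k F M := forall s : seq multi_index, uniq s ->
  \sum_(a <- s) normc (coef F a) * twoN R (- k%:Z) a <= M.

Let term_ge0 k F a : 0 <= normc (coef F a) * twoN R (- k%:Z) a.
Proof. by rewrite mulr_ge0 ?normc_ge0 ?twoN_ge0. Qed.

Lemma l1_bound_ge0 k F M : l1_bound k F M -> 0 <= M.
Proof. by move=> /(_ [::] isT); rewrite big_nil. Qed.

Lemma l1_boundW k F M N : l1_bound k F M -> M <= N -> l1_bound k F N.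
Proof. by move=> FM MN s us; exact: le_trans (FM s us) MN. Qed.

Lemma l1_bound_coef k F M a :
  l1_bound k F M -> normc (coef F a) <= M * twoN R k%:Z a.
Proof.
move=> /(_ [:: a] isT); rewrite big_seq1 -(ler_pM2r (twoN_gt0 R k%:Z a)).
by rewrite -mulrA -twoND addNr /twoN big1 ?mulr1// => j _; rewrite mul0r.
Qed.

Lemma l1_bound0 k : l1_bound k 0 0.
Proof.
by move=> s _; rewrite big1// => a _; rewrite ComplexField.Normc.normc0 mul0r.
Qed.

Lemma l1_boundD k F G M N :
  l1_bound k F M -> l1_bound k G N -> l1_bound k (F + G) (M + N).
Proof.
move=> FM GN s us; apply: le_trans (lerD (FM s us) (GN s us)).
rewrite -big_split /=; apply: ler_sum => a _.
by rewrite -mulrDl ler_wpM2r ?twoN_ge0 ?le_normcD.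
Qed.

Lemma l1_bound_const k (c : R[i]) : l1_bound k (ps_const c) (normc c).
Proof.
move=> s us; have E a : normc (coef (ps_const c) a) * twoN R (- k%:Z) a =
    if a == mi0 then normc c else 0.
  rewrite /=; case: eqP => [->|_]; first by rewrite twoN0 mulr1.
  by rewrite ComplexField.Normc.normc0 mul0r.
apply: (@le_trans _ _ (\sum_(a <- undup (mi0 :: s))
    normc (coef (ps_const c) a) * twoN R (- k%:Z) a)).
  apply: ler_sum_subset => //; first exact: undup_uniq.
  by move=> a sa; rewrite mem_undup inE sa orbT.
rewrite (bigD1_seq mi0) ?undup_uniq ?mem_undup ?inE ?eqxx//= E eqxx.
by rewrite big1 ?addr0// => a /negbTE a0; rewrite E a0.
Qed.

(** The weight is multiplicative, so a Cauchy product is dominated by the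
    product of the two sums: this is what makes the weighted l1 norm, unlike the
    Hilbert norms, submultiplicative with a fixed weight. *)
Lemma l1_boundM k F G M N :
  l1_bound k F M -> l1_bound k G N -> l1_bound k (F * G) (M * N).
Proof.
move=> FM GN s us.
pose phi H a := normc (coef H a) * twoN R (- k%:Z) a.
have phi0 H a : 0 <= phi H a by exact: term_ge0.
(* The pairs occurring in the products: they are pairwise distinct, as a pair
   determines its sum. *)
pose t := [seq ab | g <- s, ab <- midecomp g].
have ut : uniq t.
  rewrite allpairs_uniq_dep//; first by move=> g _; exact: midecomp_uniq.
  move=> [g ab] [g' ab'] /allpairsPdep[x [y [_ xy [-> ->]]]].
  move=> /allpairsPdep[x' [y' [_ xy' [-> ->]]]] /= yy.
  move: xy xy'; rewrite -yy !mem_midecomp => /eqP <- /eqP <- //.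
apply: (@le_trans _ _ (\sum_(ab <- t) phi F ab.1 * phi G ab.2)).
  rewrite big_allpairs_dep /=; apply: ler_sum => g _.
  rewrite midecompE -fsbig_seq ?midecomp_uniq//.
  apply: le_trans (ler_wpM2r (twoN_ge0 _ _ _) (normc_sum _ _)) _.
  rewrite mulr_suml big_seq [leRHS]big_seq; apply: ler_sum => ab.
  rewrite mem_midecomp => /eqP <-.
  by rewrite ComplexField.Normc.normcM twoN_add /phi mulrACA.
apply: (@le_trans _ _ (\sum_(ab <-
    [seq (a, b) | a <- undup (unzip1 t), b <- undup (unzip2 t)])
    phi F ab.1 * phi G ab.2)).
  apply: ler_sum_subset => //.
  - by rewrite allpairs_uniq ?undup_uniq// => -[? ?] [? ?].
  - move=> [a b] abt; apply/allpairsP; exists (a, b).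
    by split => //=; rewrite mem_undup; apply/mapP; exists (a, b).
  - by move=> ab; exact: mulr_ge0.
rewrite big_allpairs /=.
under eq_bigr do rewrite -mulr_sumr.
rewrite -mulr_suml ler_pM ?sumr_ge0 ?FM ?GN ?undup_uniq//.
Qed.

(** By the inequality between the arithmetic and the geometric means, the
    square-summability of the coefficients gives their summability, because the
    weight itself is summable. *)
Lemma hilbert_l1_bound k F : (2 <= k)%N -> hilbert k (coef F) ->
  exists M, l1_bound k F M.
Proof.
move=> k2 /hilbertP[M FM]; exists (M + 2) => s us.
apply: le_trans (lerD (FM s us) (sum_twoN_le2 R us)).
rewrite -big_split /=; apply: ler_sum => a _.
have w0 := twoN_ge0 R (- k%:Z) a; have wk := twoN_anti R a k2.
set x := normc (coef F a).
have := mulr_ge0 (sqr_ge0 (x - 1)) w0; have := mulr_ge0 (sqr_ge0 x) w0.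
by rewrite sqrrB1 mulrDl mulrBl mulr2n mulrDl mul1r; lra.
Qed.

(** The Hilbert spaces increase with [k], so finitely many elements of the
    inductive limit share a weight and a bound. *)
Lemma frakR_l1_bound (I : finType) (F : I -> frakR R) :
  exists k M, forall i, l1_bound k (frakR_ps (F i)) M.
Proof.
have /choice[l Fl] i : exists l : nat, hilbert l (coef (frakR_ps (F i))).
  by case: (F i) => G /= /frakR_predP[l _ Gl]; exists l.
pose k := maxn 2 (\max_i l i); exists k.
have /choice[M FM] i : exists M, l1_bound k (frakR_ps (F i)) M.
  apply: hilbert_l1_bound; first exact: leq_maxl.
  by apply: hilbert_le (Fl i); rewrite (leq_trans _ (leq_maxr _ _))// leq_bigmax.
exists (\sum_i M i) => i; apply: l1_boundW (FM i) _.
rewrite (bigD1 i)//= lerDl sumr_ge0// => j _.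
exact: l1_bound_ge0 (FM j).
Qed.

End WeightedL1.

(** * Geometric series in the Kondratiev space *)

Section GeometricSeries.
Variable R : realType.

(** The partial sums lowered, respectively raised, by the bound [2 b / 2^m] of
    the remainder form a nondecreasing, respectively nonincreasing, sequence;
    any number that separates them is the limit. *)
Lemma real_geometric_limit (u : nat -> R) (b : R) :
  (forall n, `|u n| <= b * 2^-1 ^+ n) ->
  exists S, forall m, `|S - \sum_(n < m) u n| <= 2 * b * 2^-1 ^+ m.
Proof.
move=> ub; have b0 : 0 <= b by have := ub 0%N; rewrite expr0 mulr1; apply: le_trans.
pose L m := \sum_(n < m) u n - 2 * b * 2^-1 ^+ m.
pose U m := \sum_(n < m) u n + 2 * b * 2^-1 ^+ m.
have LU m n : L m <= U n.
  have LS l : L l <= L l.+1.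
    rewrite /L big_ord_recr /= exprS; have := ub l; rewrite ler_norml => /andP[].
    move: (2^-1 ^+ l) => x; nra.
  have US l : U l.+1 <= U l.
    rewrite /U big_ord_recr /= exprS; have := ub l; rewrite ler_norml => /andP[].
    move: (2^-1 ^+ l) => x; nra.
  have Lm : L m <= L (maxn m n).
    by apply: (homo_leq (@lexx _ _) (@le_trans _ _) LS); exact: leq_maxl.
  have Un : U (maxn m n) <= U n.
    have geT (y x z : R) : y <= x -> z <= y -> z <= x by move=> xy /le_trans; exact.
    exact: (@homo_leq _ U (fun x y => y <= x) (@lexx _ _) geT US _ _ (leq_maxr m n)).
  apply: le_trans Lm (le_trans _ Un).
  rewrite lerD2l -subr_ge0 opprK addr_ge0// mulr_ge0 ?mulr_ge0 ?exprn_ge0// invr_ge0.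
pose E := (range L).
have supE : has_sup E.
  by split; [exists (L 0%N), 0%N | exists (U 0%N) => _ [n _ <-]].
exists (sup E) => m; rewrite ler_distl; apply/andP; split.
  by apply: sup_upper_bound => //; exists m.
by apply: ge_sup; [exact: supE.1 | move=> _ [n _ <-]; exact: LU].
Qed.

Lemma complex_geometric_limit (u : nat -> R[i]) (b : R) :
  (forall n, normc (u n) <= b * 2^-1 ^+ n) ->
  exists S, forall m, normc (S - \sum_(n < m) u n) <= 4 * b * 2^-1 ^+ m.
Proof.
move=> ub.
have Re_le (z : R[i]) : `|complex.Re z| <= normc z.
  by case: z => x y /=; rewrite -sqrtr_sqr ler_sqrt ?addr_ge0 ?sqr_ge0// lerDl sqr_ge0.
have Im_le (z : R[i]) : `|complex.Im z| <= normc z.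
  by case: z => x y /=; rewrite -sqrtr_sqr ler_sqrt ?addr_ge0 ?sqr_ge0// lerDr sqr_ge0.
have norm_le (z : R[i]) : normc z <= `|complex.Re z| + `|complex.Im z|.
  case: z => x y /=; rewrite -[leRHS]ger0_norm ?addr_ge0// -sqrtr_sqr.
  rewrite ler_sqrt ?sqr_ge0// -(real_normK (num_real x)) -(real_normK (num_real y)).
  by rewrite sqrrD lerD2r lerDl mulrn_wge0// mulr_ge0.
have [x xE] := real_geometric_limit (fun n => le_trans (Re_le (u n)) (ub n)).
have [y yE] := real_geometric_limit (fun n => le_trans (Im_le (u n)) (ub n)).
exists (Complex x y) => m; apply: le_trans (norm_le _) _.
rewrite !raddfB !raddf_sum /= !sumrN; have := xE m; have := yE m; lra.
Qed.

End GeometricSeries.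

Section Convergence.
Variable R : realType.

Lemma hnorm_le k (f : chaos R) (c : R) : 0 <= c ->
  (forall s, uniq s ->
    \sum_(a <- s) normc (f a) ^+ 2 * twoN R (- k%:Z) a <= c ^+ 2) ->
  (hnorm k f <= c%:E)%E.
Proof.
move=> c0 fc; have -> : c%:E = sqrte (c ^+ 2)%:E by rewrite /= sqrtr_sqr ger0_norm.
rewrite /hnorm lee_sqrt ?lee_fin ?sqr_ge0//.
apply: ge_ereal_sup => _ [X [finX _] <-].
have /finite_seqP[s ->] := finX.
have -> : [set` s]%classic = [set` undup s]%classic.
  by apply/seteqP; split => a /=; rewrite mem_undup.
by rewrite -fsbig_seq ?undup_uniq// sumEFin lee_fin fc ?undup_uniq.
Qed.

(** A neighbourhood of 0 in the inductive limit contains a ball of each of the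
    Hilbert spaces, so that a geometric rate in one of them is enough. *)
Lemma geometric_kondratiev_cvg k (u : nat -> chaos R) (f : chaos R) (c : R) :
  (0 < k)%N -> 0 <= c ->
  (forall n, (hnorm k (fun a => (u n a - f a)%R) <= (c * 2^-1 ^+ n)%R%:E)%E) ->
  kondratiev_cvg u f.
Proof.
move=> k0 c0 uf U [_ _ /(_ k k0)[e e0 eU]].
have ce0 : 0 < e / (c + 1) by rewrite divr_gt0//; lra.
exists (Num.bound (e / (c + 1))^-1) => // n /= le_n; apply: eU.
apply: le_lt_trans (uf n) _; rewrite lte_fin.
have := realalg.RealAlg.upper_nthrootVP ce0 le_n.
rewrite -exprVn ltr_pdivlMr; last by lra.
have : 0 < 2^-1 ^+ n :> R by rewrite exprn_gt0// invr_gt0.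
nra.
Qed.

(** The l1 bounds are only used through the bounds that they give for each
    coefficient: the remainder of the series at [a] is then at most a constant
    times [2^-m (2N)^(k a)], and the square of [(2N)^(k a)] is summable against
    [(2N)^(-(2k+2) a)]. No limit is exchanged with a sum over multi-indices. *)
Lemma frakR_cvg_geometric_series k (u : nat -> frakR R) (b : R) :
  (forall n, l1_bound k (frakR_ps (u n)) (b * 2^-1 ^+ n)) ->
  exists S : frakR R, frakR_cvg (fun m => \sum_(n < m) u n) S.
Proof.
move=> ub; have b0 : 0 <= b.
  by have /l1_bound_ge0 := ub 0%N; rewrite expr0 mulr1.
have /choice[S SE] a : exists S : R[i], forall m,
    normc (S - \sum_(n < m) coef (frakR_ps (u n)) a) <=
      4 * (b * twoN R k%:Z a) * 2^-1 ^+ m.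
  apply: (@complex_geometric_limit R (fun n => coef (frakR_ps (u n)) a)
    (b * twoN R k%:Z a)) => n.
  by rewrite mulrAC; exact: l1_bound_coef (ub n).
have coef_sum m a : inv_hermite (\sum_(n < m) u n) a =
    \sum_(n < m) coef (frakR_ps (u n)) a.
  elim: m => [|m IH]; first by rewrite !big_ord0.
  by rewrite !big_ord_recr /= -IH.
pose l := (2 * k + 2)%N.
have Sl m s : uniq s -> \sum_(a <- s)
    normc (S a - inv_hermite (\sum_(n < m) u n) a) ^+ 2 * twoN R (- l%:Z) a <=
      (8 * b * 2^-1 ^+ m) ^+ 2.
  move=> us.
  apply: (@le_trans _ _ (\sum_(a <- s) (4 * b * 2^-1 ^+ m) ^+ 2 * twoN R (- 2%:Z) a)).
    apply: ler_sum => a _; rewrite coef_sum.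
    have -> : - l%:Z = - k%:Z + - k%:Z + - 2%:Z by rewrite /l; lia.
    rewrite !twoND mulrA ler_wpM2r ?twoN_ge0//.
    have wK : twoN R k%:Z a * twoN R (- k%:Z) a = 1.
      by rewrite -twoND addrN /twoN big1// => j _; rewrite mul0r.
    have -> : (4 * b * 2^-1 ^+ m) ^+ 2 = (4 * (b * twoN R k%:Z a) * 2^-1 ^+ m) ^+ 2
        * (twoN R (- k%:Z) a * twoN R (- k%:Z) a).
      rewrite -[LHS]mulr1 -[X in _ * X = _](expr1n _ 2) -wK; ring.
    rewrite ler_wpM2r ?mulr_ge0 ?twoN_ge0// ler_sqr ?nnegrE ?normc_ge0//.
    exact: le_trans (normc_ge0 _) (SE a m).
  rewrite -mulr_sumr.
  apply: le_trans (ler_wpM2l (sqr_ge0 _) (sum_twoN_le2 R us)) _.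
  have := sqr_ge0 (b * 2^-1 ^+ m); nra.
have SR : PowerSeries S \in @frakR_pred R.
  apply/frakR_predP; exists l; first by rewrite /l addn2.
  apply/hilbertP; exists ((8 * b) ^+ 2) => s us.
  have := Sl 0%N s us; rewrite expr0 mulr1; apply: le_trans.
  by apply: ler_sum => a _ /=; rewrite big_ord0 subr0.
exists (FrakR SR); apply: (@geometric_kondratiev_cvg l _ _ (8 * b)).
- by rewrite /l addn2.
- by rewrite mulr_ge0.
move=> m; apply: hnorm_le; first by rewrite !mulr_ge0 ?exprn_ge0// invr_ge0.
move=> s us; apply: le_trans (Sl m s us).
by apply: ler_sum => a _ /=; rewrite -normcN opprB.
Qed.

End Convergence.

(** * Convergence of realizations *)

Section RealizationConvergence.
Variable R : realType.

Definition mx_l1_bound k m n (X : 'M[frakR R]_(m, n)) (M : R) :=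
  forall i j, l1_bound k (frakR_ps (X i j)) M.

Lemma mx_l1_boundM k m n r (X : 'M[frakR R]_(m, n)) (Y : 'M_(n, r)) M M' :
  mx_l1_bound k X M -> mx_l1_bound k Y M' ->
  mx_l1_bound k (X *m Y) (n%:R * (M * M')).
Proof.
move=> XM YM i j; rewrite mxE (_ : n%:R * _ = \sum_(l < n) M * M'); last first.
  by rewrite sumr_const card_ord mulr_natl.
elim/big_rec2: _ => [|l c F _ IH]; first exact: l1_bound0.
by apply: l1_boundD IH; apply: l1_boundM; [exact: XM | exact: YM].
Qed.

Lemma mx_l1_boundX k n (A : 'M[frakR R]_n) M r :
  mx_l1_bound k A M -> mx_l1_bound k (A ^+ r) ((n%:R * M) ^+ r).
Proof.
move=> AM; elim: r => [|r IH] i j.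
  rewrite !expr0 mxE; case: (i == j); last first.
    exact: l1_boundW (@l1_bound0 R k) _.
  have := @l1_bound_const R k 1; rewrite ComplexField.Normc.normc1; exact.
rewrite exprS -mulmxE [X in l1_bound _ _ X]exprS -mulrA.
exact: mx_l1_boundM.
Qed.

Lemma frakR_cst_bound k (z : R[i]) n :
  l1_bound k (frakR_ps (frakR_cst z ^+ n)) (normc z ^+ n).
Proof.
elim: n => [|n IH].
  have := @l1_bound_const R k 1; rewrite ComplexField.Normc.normc1; exact.
by rewrite !exprS; apply: l1_boundM IH; exact: l1_bound_const.
Qed.

(** If [M] bounds the entries of [A], [B], [C] and [D] in a common l1 norm, those
    of [A^n] are bounded by [(N M)^n], and the series converges geometrically
    for [|zeta|] below [1 / (2 (N M + 1))]. *)
Lemma realization_converges p q N (A : 'M[frakR R]_N) (B : 'M_(N, q))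
    (C : 'M_(p, N)) (D : 'M_(p, q)) H :
  (forall n, H n = realization A B C D n) -> converges_near0 H.
Proof.
move=> HE.
(* A single index type for the entries of the four matrices gives them a common
   weight and a common bound. *)
pose T : finType := ('I_N * 'I_N + 'I_N * 'I_q + ('I_p * 'I_N + 'I_p * 'I_q))%type.
pose F (t : T) : frakR R := match t with
  | inl (inl ij) => A ij.1 ij.2
  | inl (inr ij) => B ij.1 ij.2
  | inr (inl ij) => C ij.1 ij.2
  | inr (inr ij) => D ij.1 ij.2 end.
have [k [M0 FM0]] := frakR_l1_bound F.
pose M := `|M0|.
have FM t : l1_bound k (frakR_ps (F t)) M by apply: l1_boundW (FM0 t) (ler_norm _).
have M_ge0 : 0 <= M by exact: normr_ge0.
have AM : mx_l1_bound k A M by move=> i j; exact: FM (inl (inl (i, j))).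
have BM : mx_l1_bound k B M by move=> i j; exact: FM (inl (inr (i, j))).
have CM : mx_l1_bound k C M by move=> i j; exact: FM (inr (inl (i, j))).
have DM : mx_l1_bound k D M by move=> i j; exact: FM (inr (inr (i, j))).
pose r : R := N%:R * M.
have r0 : 0 <= r by rewrite mulr_ge0.
have d0 : 0 < 2 * (r + 1) by lra.
exists (2 * (r + 1))^-1; first by rewrite invr_gt0.
move=> z ze.
have [z2 zr2] : normc z <= 2^-1 /\ normc z * r <= 2^-1.
  have z0 := normc_ge0 z.
  have : normc z * (2 * (r + 1)) < 1 by rewrite -ltr_pdivlMr// div1r.
  have := mulr_ge0 z0 r0; split; lra.
pose b := M + N%:R * (N%:R * M * M).
have c0 : 0 <= N%:R * (N%:R * M * M) by rewrite !mulr_ge0.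
have uB i j n :
    l1_bound k (frakR_ps ((frakR_cst z ^+ n *: H n) i j)) (b * 2^-1 ^+ n).
  rewrite mxE; case: n => [|n].
    apply: l1_boundW (l1_boundM (frakR_cst_bound k z 0) (_ : l1_bound _ _ M)) _.
      by rewrite HE /realization /= addr0; exact: DM.
    by rewrite !expr0 mul1r mulr1 lerDl.
  have HM : mx_l1_bound k (H n.+1) (N%:R * (N%:R * (M * r ^+ n) * M)).
    rewrite HE /realization /= add0r /resolvent.
    by apply: mx_l1_boundM BM; apply: mx_l1_boundM CM _; exact: mx_l1_boundX.
  apply: l1_boundW (l1_boundM (frakR_cst_bound k z n.+1) (HM i j)) _.
  have -> : normc z ^+ n.+1 * (N%:R * (N%:R * (M * r ^+ n) * M)) =
      N%:R * (N%:R * M * M) * (normc z * (normc z * r) ^+ n).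
    rewrite exprS (exprMn n (normc z) r); ring.
  apply: ler_pM => //; first by rewrite mulr_ge0 ?exprn_ge0 ?mulr_ge0 ?normc_ge0.
    by rewrite lerDr.
  rewrite exprS ler_pM ?normc_ge0 ?exprn_ge0 ?mulr_ge0 ?normc_ge0//.
  by rewrite lerXn2r ?nnegrE ?mulr_ge0 ?normc_ge0// invr_ge0.
have /choice[S SE] (ij : 'I_p * 'I_q) : exists S, frakR_cvg
    (fun m => (\sum_(n < m) frakR_cst z ^+ n *: H n) ij.1 ij.2) S.
  have [S SE] := frakR_cvg_geometric_series (uB ij.1 ij.2).
  exists S; congr (frakR_cvg _ _): SE; apply/funext => m.
  by rewrite summxE.
by exists (\matrix_(i, j) S (i, j)) => i j; rewrite mxE; exact: SE (i, j).
Qed.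

End RealizationConvergence.

(** * The equivalence *)

Theorem theorem4p1 (R : realType) (p q : nat)
    (H : nat -> 'M[frakR R]_(p, q)) :
  [<-> forall (i : 'I_p) (j : 'I_q), zeta_rational (fun n => H n i j);
       exists (N : nat) (A : 'M[frakR R]_N) (B : 'M[frakR R]_(N, q))
              (C : 'M[frakR R]_(p, N)) (D : 'M[frakR R]_(p, q)),
         forall n, H n = realization A B C D n;
       converges_near0 H /\
       exists M : nat, forall n, (M <= n)%N ->
         exists c : nat -> frakR R, forall m,
           iter n R0 H m = \sum_(1 <= j < M) c j *: iter j R0 H m].
Proof.
tfae.
- exact: realization_of_rational.
- move=> [N [A [B [C [D HE]]]]]; split; first exact: realization_converges HE.
  by exists N.+1; exact: R0_span_of_realization HE.
- by move=> [_ [M /(_ M (leqnn M))[c]]]; exact: rational_of_R0_span.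
Qed.
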